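(* Let $k$ be a field. For every integer $N\ge1$ there exist a topological space $X$, a function $\tilde f:I\times X\to\mathbb{R}$ and an integer $j\ge0$ such that the multiparameter persistence module $H_jF$ (with coefficients in $k$) associated to $\tilde f$ is indecomposable and its maximum dimension $\max_{(a,b,c)\in\Delta^2\times\mathbb{R}}\dim_k H_jF(a,b,c)$ is finite and at least $N$.
   Context: $I=[0,1]$. Let $\Delta^2=\{(a,b)\mid 0\le a\le b\le 1\}$, partially ordered by $(a,b)\le(a',b')$ iff $a'\le a\le b\le b'$. The poset $\Delta^2\times\mathbb{R}$ has the product order, with the usual order on $\mathbb{R}$, and is regarded as a category. Given $\tilde f:I\times X\to\mathbb{R}$, let $f:I\times X\to I\times\mathbb{R}$, $f(t,x)=(t,\tilde f(t,x))$. The associated diagram of spaces is the functor $F$ from $\Delta^2\times\mathbb{R}$ to topological spaces with $F(a,b,c)=f^{-1}([a,b]\times(-\infty,c])\subset I\times X$ (subspace topology) and morphisms the inclusions. The associated multiparameter persistence module $H_jF$ is its composition with singular homology $H_j(-;k)$, a functor from $\Delta^2\times\mathbb{R}$ to $k$-vector spaces. Direct sums of such functors are taken pointwise; $H_jF$ is indecomposable if it is not isomorphic to a direct sum of two nonzero functors from $\Delta^2\times\mathbb{R}$ to $k$-vector spaces. *)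

(* Defs.v *)
From HB Require Import structures.
From mathcomp Require Import all_boot all_order all_algebra.
From mathcomp Require Import all_classical all_reals topology normedtype.
From mathcomp Require Import freeg.

Set Implicit Arguments.
Unset Strict Implicit.
Unset Printing Implicit Defensive.

Import Order.TTheory GRing.Theory Num.Theory.
Import numFieldNormedType.Exports.

Local Open Scope classical_set_scope.
Local Open Scope ring_scope.
Local Open Scope quotient_scope.

Section QuotientModule.
Context {K : pzRingType} {V : lmodType K} (W : {pred V}) (modW : submod_closed W).

Let zW : zmodClosed V :=
  HB.pack (W : V -> bool)
    (GRing.isZmodClosed.Build V W (GRing.subsemimod_closedB modW)).

Definition quotmod : Type := Quotient.quot zW.
HB.instance Definition _ := GRing.Zmodule.on quotmod.

Definition quot_proj (v : V) : quotmod := \pi_(Quotient.quot zW) v.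

Lemma quot_proj_eqP v w : quot_proj v = quot_proj w <-> v - w \in W.
Proof.
rewrite -[v - w \in W]/(v - w \in zW) Quotient.idealrBE.
by split=> [/eqP|/eqP].
Qed.

Definition quot_repr (x : quotmod) : V := repr (x : Quotient.quot zW).

Lemma quot_reprK : cancel quot_repr quot_proj.
Proof. by move=> x; rewrite /quot_proj reprK. Qed.

Lemma quot_projD v w : quot_proj (v + w) = quot_proj v + quot_proj w.
Proof. exact: (raddfD (\pi_(Quotient.quot zW))). Qed.

Definition quot_scale (a : K) (x : quotmod) : quotmod :=
  quot_proj (a *: quot_repr x).

Lemma quot_scale_proj a v : quot_scale a (quot_proj v) = quot_proj (a *: v).
Proof.
apply/quot_proj_eqP; rewrite -scalerBr.
apply: (GRing.subsemimod_closedZ modW).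
by apply/quot_proj_eqP; rewrite quot_reprK.
Qed.

Lemma quot_scaleA a b x : quot_scale a (quot_scale b x) = quot_scale (a * b) x.
Proof. by rewrite -[x]quot_reprK !quot_scale_proj scalerA. Qed.

Lemma quot_scale1 : left_id 1 quot_scale.
Proof. by move=> x; rewrite -[x]quot_reprK quot_scale_proj scale1r. Qed.

Lemma quot_scaleDr : right_distributive quot_scale +%R.
Proof.
move=> a x y; rewrite -[x]quot_reprK -[y]quot_reprK.
by rewrite -quot_projD !quot_scale_proj scalerDr quot_projD.
Qed.

Lemma quot_scaleDl x : {morph quot_scale^~ x : a b / a + b}.
Proof.
by move=> a b; rewrite -[x]quot_reprK !quot_scale_proj scalerDl quot_projD.
Qed.

HB.instance Definition _ := GRing.Zmodule_isLmodule.Build K quotmod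
  quot_scaleA quot_scale1 quot_scaleDr quot_scaleDl.

Lemma quot_proj_linear : linear quot_proj.
Proof. by move=> a v w; rewrite quot_projD -quot_scale_proj. Qed.

HB.instance Definition _ := GRing.isLinear.Build K V quotmod _ quot_proj
  quot_proj_linear.

End QuotientModule.

Section QuotientMap.
Context {K : pzRingType} {V1 V2 : lmodType K} (W1 : {pred V1}) (W2 : {pred V2}).
Context (modW1 : submod_closed W1) (modW2 : submod_closed W2).
Context (f : {linear V1 -> V2}).

(* [fW] is a parameter only so that the map is linear. *)
Definition quot_map (fW : {homo f : v / v \in W1 >-> v \in W2})
    (x : quotmod modW1) : quotmod modW2 :=
  quot_proj modW2 (f (quot_repr x)).

Hypothesis fW : {homo f : v / v \in W1 >-> v \in W2}.

Lemma quot_map_proj v : quot_map fW (quot_proj modW1 v) = quot_proj modW2 (f v).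
Proof.
apply/quot_proj_eqP; rewrite -linearB; apply: fW.
by apply/(quot_proj_eqP modW1); rewrite quot_reprK.
Qed.

Lemma quot_map_linear : linear (quot_map fW).
Proof.
move=> a x y; rewrite -[x]quot_reprK -[y]quot_reprK.
by rewrite -linearP !quot_map_proj !linearP.
Qed.

HB.instance Definition _ :=
  GRing.isLinear.Build K (quotmod modW1) (quotmod modW2) _ (quot_map fW)
    quot_map_linear.

End QuotientMap.

Section FgliftLinear.
Context {K : fieldType} {S : choiceType} {M : lmodType K} (f : S -> M).

Lemma fglift_linear : linear (fglift f : {freeg S / K} -> M).
Proof.
have addf : zmod_morphism (fglift f : {freeg S / K} -> M).
  exact: lift_is_additive.
pose F : {additive {freeg S / K} -> M} :=
  HB.pack (fglift f) (GRing.isZmodMorphism.Build _ _ _ addf).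
suff sc a D : F (a *: D) = a *: F D by move=> a D E; rewrite -sc -raddfD.
have -> : F D = \sum_(x <- dom D) coeff x D *: f x.
  rewrite -[in LHS](freeg_sumE D) raddf_sum.
  by apply: eq_bigr => x _; rewrite /F/= liftU.
rewrite -[a *: D]/(fgscale a D) /fgscale raddf_sum scaler_sumr.
by apply: eq_bigr => x _; rewrite /F/= liftU scalerA.
Qed.

HB.instance Definition _ :=
  GRing.isLinear.Build K {freeg S / K} M _ (fglift f) fglift_linear.

End FgliftLinear.

Lemma freeg_linear_ext (K : fieldType) (S : choiceType) (M : lmodType K)
    (f g : {linear {freeg S / K} -> M}) :
  (forall s, f << s >> = g << s >>) -> f =1 g.
Proof.
move=> fg D; rewrite -(freeg_sumE D) !linear_sum; apply: eq_bigr => x _.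
have -> : << coeff x D *g x >> = coeff x D *: (<< x >> : {freeg S / K}).
  by apply/eqP/freeg_eqP => y; rewrite coeffZ !coeffU mul1r.
by rewrite !linearZ_LR fg.
Qed.

Section StandardSimplex.
Context (R : realType).

Definition std_simplex (n : nat) : set 'rV[R]_n.+1 :=
  [set x | (forall i, 0 <= x ord0 i) /\ \sum_i x ord0 i = 1].
Arguments std_simplex : clear implicits.

Definition face_fun n (i : 'I_n.+2) (x : 'rV[R]_n.+1) : 'rV[R]_n.+2 :=
  \row_j (if unlift i j is Some j' then x ord0 j' else 0).

Lemma face_fun_simplex n i (x : std_simplex n) :
  face_fun i (set_val x) \in std_simplex n.+1.
Proof.
have [x0 x1] : std_simplex n (set_val x) by exact: set_valP.
rewrite inE; split.
  by move=> j; rewrite mxE; case: unlift.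
rewrite (bigD1_ord i)//= mxE unlift_none add0r -[RHS]x1.
by apply: eq_bigr => j _; rewrite mxE liftK.
Qed.

(* The [i]-th face inclusion inserts a zero at the [i]-th coordinate. *)
Definition face n (i : 'I_n.+2) (x : std_simplex n) : std_simplex n.+1 :=
  exist _ (face_fun i (set_val x)) (face_fun_simplex i x).

Lemma face_continuous n (i : 'I_n.+2) : continuous (@face n i).
Proof.
apply: continuous_comp_initial => x A [P xP sPA].
have cx : {for x, continuous (set_val : std_simplex n -> 'rV[R]_n.+1)}.
  exact: initial_continuous.
apply: (cx (face_fun i @^-1` A)).
exists (fun a b => P a (fintype.lift i b)).
  move=> a b; have := xP a (fintype.lift i b).
  by rewrite /= mxE liftK (ord1 a).
move=> y yP; apply: sPA => a j; rewrite mxE.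
have := xP a j; rewrite /= mxE; case: unliftP => [j' ->|_] xPj.
  by have := yP a j'; rewrite (ord1 a).
exact: nbhs_singleton.
Qed.

HB.instance Definition _ n (i : 'I_n.+2) :=
  isContinuous.Build _ _ (@face n i) (@face_continuous n i).

End StandardSimplex.

Arguments std_simplex : clear implicits.

Section SingularChains.
Context (R : realType) (k : fieldType).
Implicit Types (X Y Z : topologicalType) (n : nat).

Definition sing_simplex n X : choiceType :=
  continuousType (std_simplex R n) X.

Definition sing_chain n X : lmodType k := {freeg (sing_simplex n X) / k}.

Definition sing_bdry_simplex n X (s : sing_simplex n.+1 X) : sing_chain n X :=
  \sum_(i < n.+2)
    (-1) ^+ i *: (<< (s \o face i : sing_simplex n X) >> : sing_chain n X).

(* The boundary [C_n -> C_(n-1)]; it is zero for [n = 0]. *)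
Definition sing_bdry n X : {linear sing_chain n X -> sing_chain n.-1 X} :=
  match n with
  | 0 => \0
  | m.+1 => fglift (@sing_bdry_simplex m X)
  end.

Definition sing_push n X Y (f : continuousType X Y) :
    {linear sing_chain n X -> sing_chain n Y} :=
  fglift (fun s : sing_simplex n X =>
    << (f \o s : sing_simplex n Y) >> : sing_chain n Y).

Lemma sing_pushU n X Y (f : continuousType X Y) (s : sing_simplex n X) :
  sing_push n f << s >> = << (f \o s : sing_simplex n Y) >>.
Proof. by rewrite /sing_push/= liftU scale1r. Qed.

Lemma sing_bdryU n X (s : sing_simplex n.+1 X) :
  sing_bdry n.+1 X << s >> = sing_bdry_simplex s.
Proof. by rewrite /sing_bdry/= liftU scale1r. Qed.

Lemma sing_push_bdry n X Y (f : continuousType X Y) (c : sing_chain n X) :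
  sing_bdry n Y (sing_push n f c) = sing_push n.-1 f (sing_bdry n X c).
Proof.
case: n c => [|n] c; first by rewrite /= linear0.
apply: (@freeg_linear_ext k _ _ (sing_bdry n.+1 Y \o sing_push n.+1 f)
  (sing_push n f \o sing_bdry n.+1 X)) => s.
rewrite -[LHS]/(sing_bdry n.+1 Y (sing_push n.+1 f << s >>)).
rewrite -[RHS]/(sing_push n f (sing_bdry n.+1 X << s >>)).
rewrite sing_pushU !sing_bdryU /sing_bdry_simplex linear_sum/=.
apply: eq_bigr => i _; rewrite linearZ/= sing_pushU; congr (_ *: << _ >>).
exact/continuousEP.
Qed.

Lemma sing_push_id n X (f : continuousType X X) (c : sing_chain n X) :
  f =1 id -> sing_push n f c = c.
Proof.
move=> f1; apply: (@freeg_linear_ext k _ _ (sing_push n f) idfun) => s.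
by rewrite sing_pushU; congr << _ >>; apply/continuousEP => x /=; rewrite f1.
Qed.

Lemma sing_push_comp n X Y Z (f : continuousType X Y) (g : continuousType Y Z)
    (h : continuousType X Z) (c : sing_chain n X) : g \o f =1 h ->
  sing_push n g (sing_push n f c) = sing_push n h c.
Proof.
move=> gf.
apply: (@freeg_linear_ext k _ _ (sing_push n g \o sing_push n f)
  (sing_push n h)) => s.
rewrite -[LHS]/(sing_push n g (sing_push n f << s >>)) !sing_pushU; congr << _ >>.
by apply/continuousEP => x; rewrite /= -gf.
Qed.

End SingularChains.

Section SingularHomology.
Context (R : realType) (k : fieldType).
Implicit Types (X Y Z : topologicalType) (n : nat).

Definition is_cycle n X : {pred sing_chain R k n X} :=
  [pred c | sing_bdry R k n X c == 0].
Arguments is_cycle : clear implicits.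

Lemma is_cycle_submod n X : submod_closed (is_cycle n X).
Proof.
split=> [|a c d]; rewrite !inE ?linear0// => /eqP c0 /eqP d0.
by rewrite linearP c0 d0 scaler0 addr0.
Qed.

HB.instance Definition _ n X :=
  GRing.isSubmodClosed.Build k (sing_chain R k n X) (is_cycle n X)
    (is_cycle_submod n X).

Definition sing_cycle n X := {c : sing_chain R k n X | is_cycle n X c}.

HB.instance Definition _ n X := SubChoice.on (sing_cycle n X).
HB.instance Definition _ n X := [SubChoice_isSubLmodule of sing_cycle n X by <:].

(* Restricted to cycles, so that homology is a quotient of [sing_cycle]. *)
Definition is_boundary n X : {pred sing_cycle n X} :=
  [pred z | `[< exists c, sing_bdry R k n.+1 X c = \val z >]].
Arguments is_boundary : clear implicits.

Lemma is_boundary_submod n X : submod_closed (is_boundary n X).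
Proof.
split=> [|a z w]; first by apply/asboolP; exists 0; rewrite !linear0.
move=> /asboolP[c cz] /asboolP[d dw]; apply/asboolP.
by exists (a *: c + d); rewrite !linearP cz dw.
Qed.

Definition sing_homology n X : lmodType k := quotmod (is_boundary_submod n X).

Section Functoriality.
Context n X Y (f : continuousType X Y).

Lemma sing_push_cycle (z : sing_cycle n X) :
  is_cycle n Y (sing_push R k n f (\val z)).
Proof.
by rewrite /is_cycle/= sing_push_bdry (eqP (valP z)) linear0.
Qed.

Definition sing_push_cycles (z : sing_cycle n X) : sing_cycle n Y :=
  exist _ (sing_push R k n f (\val z)) (sing_push_cycle z).

Lemma sing_push_cycles_linear : linear sing_push_cycles.
Proof. by move=> a z w; apply: val_inj; rewrite /= linearP. Qed.

HB.instance Definition _ := GRing.isLinear.Build k _ _ _ sing_push_cycles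
  sing_push_cycles_linear.

Lemma sing_push_boundary :
  {homo sing_push_cycles : z / z \in is_boundary n X >-> z \in is_boundary n Y}.
Proof.
move=> z /asboolP[c cz]; apply/asboolP.
by exists (sing_push R k n.+1 f c); rewrite sing_push_bdry cz.
Qed.

Definition sing_homology_map : {linear sing_homology n X -> sing_homology n Y} :=
  @quot_map k _ _ _ _ (is_boundary_submod n X) (is_boundary_submod n Y) _
    sing_push_boundary.

End Functoriality.

Lemma sing_homology_map_id n X (f : continuousType X X) (x : sing_homology n X) :
  f =1 id -> sing_homology_map n f x = x.
Proof.
move=> f1; rewrite -[x]quot_reprK /= quot_map_proj; congr quot_proj.
by apply: val_inj; rewrite /= sing_push_id.
Qed.

Lemma sing_homology_map_comp n X Y Z (f : continuousType X Y)
    (g : continuousType Y Z) (h : continuousType X Z) (x : sing_homology n X) :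
  g \o f =1 h ->
  sing_homology_map n g (sing_homology_map n f x) = sing_homology_map n h x.
Proof.
move=> gf; rewrite -[x]quot_reprK /= !quot_map_proj; congr quot_proj.
by apply: val_inj; rewrite /= (sing_push_comp _ gf).
Qed.

End SingularHomology.

Section Functors.
Context (k : fieldType) (d : Order.disp_t) (P : porderType d).

Record space_diagram := SpaceDiagram {
  space_at :> P -> topologicalType;
  space_map : forall p q, (p <= q)%O ->
    continuousType (space_at p) (space_at q);
  space_map_id : forall p (pp : (p <= p)%O), space_map pp =1 id;
  space_map_comp : forall p q r
    (pq : (p <= q)%O) (qr : (q <= r)%O) (pr : (p <= r)%O),
    space_map qr \o space_map pq =1 space_map pr }.

Record pers_module := PersModule {
  module_at :> P -> lmodType k;
  module_map : forall p q, (p <= q)%O -> {linear module_at p -> module_at q};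
  module_map_id : forall p (pp : (p <= p)%O), module_map pp =1 id;
  module_map_comp : forall p q r
    (pq : (p <= q)%O) (qr : (q <= r)%O) (pr : (p <= r)%O),
    module_map qr \o module_map pq =1 module_map pr }.

Record pers_hom (M N : pers_module) := PersHom {
  hom_at :> forall p, {linear M p -> N p};
  hom_natural : forall p q (pq : (p <= q)%O) v,
    hom_at q (module_map M pq v) = module_map N pq (hom_at p v) }.

Definition pers_iso (M N : pers_module) : Prop :=
  exists (f : pers_hom M N) (g : pers_hom N M),
    forall p, cancel (f p) (g p) /\ cancel (g p) (f p).

Definition pers_nonzero (M : pers_module) : Prop := exists p (v : M p), v != 0.

Section DirectSum.
Context (M N : pers_module).

Definition dsum_map p q (pq : (p <= q)%O) (v : M p * N p) : M q * N q :=
  (module_map M pq v.1, module_map N pq v.2).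

Lemma dsum_map_linear p q (pq : (p <= q)%O) : linear (dsum_map pq).
Proof. by move=> a u v; rewrite /dsum_map/= !linearP. Qed.

HB.instance Definition _ p q (pq : (p <= q)%O) :=
  GRing.isLinear.Build k (M p * N p)%type (M q * N q)%type _ (dsum_map pq)
    (dsum_map_linear pq).

Lemma dsum_map_id p (pp : (p <= p)%O) : dsum_map pp =1 id.
Proof. by case=> u v; rewrite /dsum_map/= !module_map_id. Qed.

Lemma dsum_map_comp p q r
    (pq : (p <= q)%O) (qr : (q <= r)%O) (pr : (p <= r)%O) :
  dsum_map qr \o dsum_map pq =1 dsum_map pr.
Proof.
case=> u v; rewrite /dsum_map/=.
by congr pair; exact: module_map_comp.
Qed.

Definition pers_dsum : pers_module :=
  @PersModule (fun p => (M p * N p)%type) (fun p q pq => dsum_map pq)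
    dsum_map_id dsum_map_comp.

End DirectSum.

Definition indecomposable (M : pers_module) : Prop :=
  forall M1 M2, pers_nonzero M1 -> pers_nonzero M2 ->
    ~ pers_iso M (pers_dsum M1 M2).

Definition has_dim (V : lmodType k) (n : nat) : Prop :=
  exists2 f : V -> 'rV[k]_n, linear f & bijective f.

Definition has_max_dim (M : pers_module) (m : nat) : Prop :=
  (exists p, has_dim (M p) m) /\
  (forall p, exists2 n, has_dim (M p) n & (n <= m)%N).

Definition homology_module (R : realType) (F : space_diagram) (j : nat) :
    pers_module :=
  @PersModule (fun p => sing_homology R k j (F p))
    (fun p q pq => sing_homology_map R k j (space_map F pq))
    (fun p pp x => sing_homology_map_id x (@space_map_id F p pp))
    (fun p q r pq qr pr x =>
      sing_homology_map_comp x (@space_map_comp F p q r pq qr pr)).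

End Functors.

Fact delta2_display : Order.disp_t. Proof. exact: Order.Disp tt tt. Qed.

Section Delta2.
Context (R : realType).

Definition unit_itv : set R := `[0, 1]%classic.

Definition is_delta2 (ab : R * R) : bool :=
  [&& 0 <= ab.1, ab.1 <= ab.2 & ab.2 <= 1].

Record delta2 := Delta2 {
  delta2_val :> R * R;
  _ : is_delta2 delta2_val }.

HB.instance Definition _ := [isSub for delta2_val].
HB.instance Definition _ := [Choice of delta2 by <:].

(* The interval [a, b] of [p] is contained in that of [q]. *)
Definition delta2_le : rel delta2 := fun p q =>
  (q.1 <= p.1) && (p.2 <= q.2).

Lemma delta2_le_refl : reflexive delta2_le.
Proof. by move=> p; rewrite /delta2_le !lexx. Qed.

Lemma delta2_le_anti : antisymmetric delta2_le.
Proof.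
move=> p q /andP[/andP[qp1 pq2] /andP[pq1 qp2]]; apply: val_inj.
rewrite [LHS]surjective_pairing [RHS]surjective_pairing.
by congr pair; apply: le_anti; apply/andP.
Qed.

Lemma delta2_le_trans : transitive delta2_le.
Proof.
move=> q p r /andP[qp1 pq2] /andP[rq1 qr2].
by rewrite /delta2_le (le_trans rq1 qp1) (le_trans pq2 qr2).
Qed.

HB.instance Definition _ := Order.Le_isPOrder.Build delta2_display delta2
  delta2_le_refl delta2_le_anti delta2_le_trans.

End Delta2.

Arguments unit_itv : clear implicits.

Section FamilyDiagram.
Context (R : realType) (X : topologicalType) (ft : unit_itv R * X -> R).

Local Notation I := (unit_itv R : Type).
Local Notation P := (delta2 R *p R)%type.

Definition family_map (u : I * X) : I * R := (u.1, ft u).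

Definition family_space (p : P) : set (I * X) :=
  let: (ab, c) := p in
  family_map @^-1`
    ([set s : I | ab.1 <= val s <= ab.2] `*` `]-oo, c]%classic).

Lemma family_space_sub (p q : P) : (p <= q)%O ->
  family_space p `<=` family_space q.
Proof.
case: p q => [ab c] [ab' c'] /andP[/= /andP[a'a bb'] cc'].
rewrite /family_space !set_itvE => -[s x] [] /= /andP[as_ sb] fc; split=> /=.
  by rewrite (le_trans a'a as_) (le_trans sb bb').
exact: le_trans fc cc'.
Qed.

Definition family_incl (p q : P) (pq : (p <= q)%O) (u : family_space p) :
    family_space q :=
  exist _ (val u) (mem_set (family_space_sub pq (set_mem (valP u)))).

Lemma family_incl_continuous (p q : P) (pq : (p <= q)%O) :
  continuous (family_incl pq).
Proof. by apply: continuous_comp_initial; exact: initial_continuous. Qed.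

HB.instance Definition _ (p q : P) (pq : (p <= q)%O) :=
  isContinuous.Build _ _ (family_incl pq) (@family_incl_continuous p q pq).

Lemma family_incl_id (p : P) (pp : (p <= p)%O) : family_incl pp =1 id.
Proof. by move=> u; apply: val_inj. Qed.

Lemma family_incl_comp (p q r : P)
    (pq : (p <= q)%O) (qr : (q <= r)%O) (pr : (p <= r)%O) :
  family_incl qr \o family_incl pq =1 family_incl pr.
Proof. by move=> u; apply: val_inj. Qed.

Definition family_diagram : space_diagram P :=
  @SpaceDiagram _ P (fun p => family_space p) (fun p q pq => family_incl pq)
    family_incl_id family_incl_comp.

End FamilyDiagram.

Definition family_module (R : realType) (k : fieldType) (X : topologicalType)
    (ft : unit_itv R * X -> R) (j : nat) : pers_module k (delta2 R *p R)%type :=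
  homology_module k R (family_diagram ft) j.

(* Main.v *)
Require Import Defs.
From HB Require Import structures.
From mathcomp Require Import all_boot all_order all_algebra.
From mathcomp Require Import all_classical all_reals topology normedtype.
From mathcomp Require Import freeg lra.

Set Implicit Arguments.
Unset Strict Implicit.
Unset Printing Implicit Defensive.

Import Order.TTheory GRing.Theory Num.Theory.
Import numFieldNormedType.Exports.

Local Open Scope classical_set_scope.
Local Open Scope ring_scope.

(** Take X to be a point, j = 0, and f equal to 0 at N points of I and to 1
    elsewhere.  For c >= 1 all spaces F(a, b, c) are intervals, with
    one-dimensional H_0; for 0 <= c < 1 F(a, b, c) is the discrete set of the
    marked points in [a, b], and all N of them lie in F(0, 1, c).

    An endomorphism of H_0 F acts on the line H_0 F(0, 1, 1) by some scalar a.
    Every point (t, x) of F(a, b, c) is the only point of F(t, t, f(t)), where the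
    endomorphism is thus a scalar, and this scalar is a because the class of the
    point has a nonzero image in H_0 F(0, 1, 1).  Point classes span, so every
    endomorphism is multiplication by a scalar.  A direct sum decomposition would
    yield an idempotent endomorphism that is neither 0 nor 1. *)

(** * Persistence modules whose endomorphisms are all scalars *)

Section ScalarEndomorphisms.
Context (k : fieldType) (d : Order.disp_t) (P : porderType d).

Section Comp.
Context (L M N : pers_module k P) (f : pers_hom L M) (g : pers_hom M N).

Lemma pers_comp_natural p q (pq : (p <= q)%O) v :
  (g q \o f q) (module_map L pq v) = module_map N pq ((g p \o f p) v).
Proof. by rewrite /= !hom_natural. Qed.

Definition pers_comp : pers_hom L N :=
  @PersHom k d P L N (fun p => g p \o f p) pers_comp_natural.

End Comp.

Section Idempotent.
Context (M N : pers_module k P).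

Definition dsum_fst p (u : pers_dsum M N p) : pers_dsum M N p := (u.1, 0).

Lemma dsum_fst_linear p : linear (@dsum_fst p).
Proof. by move=> a u v; rewrite /dsum_fst/= -[RHS]/(_, _)/= scaler0 addr0. Qed.

HB.instance Definition _ p :=
  GRing.isLinear.Build k (pers_dsum M N p) (pers_dsum M N p) _ (@dsum_fst p)
    (@dsum_fst_linear p).

Lemma dsum_fst_natural p q (pq : (p <= q)%O) v :
  @dsum_fst q (module_map (pers_dsum M N) pq v) =
  module_map (pers_dsum M N) pq (@dsum_fst p v).
Proof. by rewrite /dsum_fst/= /dsum_map/= linear0. Qed.

Definition dsum_fst_hom : pers_hom (pers_dsum M N) (pers_dsum M N) :=
  @PersHom k d P _ _ (fun p => @dsum_fst p) dsum_fst_natural.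

End Idempotent.

(** Carry the projection to the first summand over to [M] along the isomorphism; by assumption it is
    multiplication by some [a]. A nonzero vector of [M1] is fixed by it, so [a = 1]; a nonzero
    vector of [M2] is killed by it, a contradiction. *)
Lemma scalar_end_indecomposable (M : pers_module k P) :
  (forall phi : pers_hom M M, exists a, forall p v, phi p v = a *: v) ->
  indecomposable M.
Proof.
move=> scal M1 M2 [p [v v0]] [q [w w0]] [f [g fg]].
have [a ha] := scal (pers_comp f (pers_comp (dsum_fst_hom M1 M2) g)).
have ginj r u : g r u = 0 -> u = 0.
  by move=> gu; rewrite -[u](fg r).2 gu linear0.
have a1 : a = 1.
  have /= := ha p (g p (v, 0)); rewrite (fg p).2 /dsum_fst/= => /eqP.
  rewrite -subr_eq0 -[X in X - _]scale1r -scalerBl scaler_eq0 subr_eq0.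
  case/orP => [/eqP //|/eqP/ginj[] v00].
  by rewrite v00 eqxx in v0.
have /= := ha q (g q (0, w)); rewrite (fg q).2 /dsum_fst/= a1 scale1r.
rewrite -[(0, 0)]/(0 : pers_dsum M1 M2 q) linear0 => /esym/ginj[] w00.
by rewrite w00 eqxx in w0.
Qed.

End ScalarEndomorphisms.

(** * Zeroth singular homology and path components *)

Section ZerothHomology.
Context (R : realType) (k : fieldType).
Implicit Types Y Z : topologicalType.

Lemma simplex0_point_subproof : (const_mx 1 : 'rV[R]_1) \in std_simplex R 0.
Proof.
rewrite inE; split => [i|]; first by rewrite mxE.
by rewrite big_ord1 mxE.
Qed.

Definition simplex0_point : std_simplex R 0 :=
  exist _ (const_mx 1) simplex0_point_subproof.

Lemma simplex0_pointE (x : std_simplex R 0) : x = simplex0_point.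
Proof.
apply: val_inj; apply/rowP => i; rewrite mxE (ord1 i).
have [_ ] : std_simplex R 0 (set_val x) by exact: set_valP.
by rewrite big_ord1.
Qed.

(** The index names the coordinate that vanishes: [vertex ord0] is the point (0, 1) and
    [vertex ord_max] is (1, 0). With this indexing the boundary of an edge is its value at
    [vertex ord0] minus its value at [vertex ord_max]. *)
Definition vertex (i : 'I_2) : std_simplex R 1 := face i simplex0_point.

Definition joined Y (y z : Y) : Prop :=
  exists s : sing_simplex R 1 Y, s (vertex ord0) = y /\ s (vertex ord_max) = z.

Section Classes.
Context Y.

Lemma chain0_cycle (c : sing_chain R k 0 Y) : @is_cycle R k 0 Y c.
Proof. by rewrite /is_cycle/=. Qed.

Definition chain_class (c : sing_chain R k 0 Y) : sing_homology R k 0 Y :=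
  quot_proj _ (exist _ c (chain0_cycle c) : sing_cycle R k 0 Y).

Lemma chain_class_linear : linear chain_class.
Proof.
move=> a c e; rewrite /chain_class -linearP; congr quot_proj.
exact: val_inj.
Qed.

HB.instance Definition _ :=
  GRing.isLinear.Build k _ _ _ chain_class chain_class_linear.

Definition point_simplex (y : Y) : sing_simplex R 0 Y := cst y.

Definition point_class (y : Y) : sing_homology R k 0 Y :=
  chain_class << point_simplex y >>.

Lemma point_simplexE (s : sing_simplex R 0 Y) :
  s = point_simplex (s simplex0_point).
Proof. by apply/continuousEP => x /=; rewrite (simplex0_pointE x). Qed.

Lemma chain_class_surj x : exists c, x = chain_class c.
Proof.
exists (\val (quot_repr x)); rewrite -[LHS]quot_reprK.
by congr quot_proj; exact: val_inj.
Qed.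

(** Each singular 0-simplex is constant and each 0-chain is a cycle, so point classes span. Stating
    this as an induction principle avoids handling finite sums later. *)
Lemma H0_ind (P : sing_homology R k 0 Y -> Prop) :
  P 0 -> (forall a y x, P x -> P (a *: point_class y + x)) -> forall x, P x.
Proof.
move=> P0 PS x; have [c ->] := chain_class_surj x; rewrite -(freeg_sumE c) linear_sum.
elim: (dom c) => [|s r IH]; first by rewrite big_nil.
rewrite big_cons; have -> : << coeff s c *g s >> = coeff s c *: << s >>
    :> sing_chain R k 0 Y.
  by apply/eqP/freeg_eqP => y; rewrite coeffZ !coeffU mul1r.
by rewrite linearZ/= {2}(point_simplexE s); exact: PS.
Qed.

Lemma bdry_edge (s : sing_simplex R 1 Y) :
  sing_bdry R k 1 Y << s >> =
  << point_simplex (s (vertex ord0)) >> - << point_simplex (s (vertex ord_max)) >>.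
Proof.
rewrite sing_bdryU /sing_bdry_simplex big_ord_recl big_ord1 /= expr0 expr1.
rewrite scale1r scaleN1r.
congr (<< _ >> - << _ >>); apply/continuousEP => x /=;
  rewrite (simplex0_pointE x) //.
by congr (s (face _ _)); apply: val_inj.
Qed.

Lemma joined_point_class y z : joined y z -> point_class y = point_class z.
Proof.
move=> [s [<- <-]]; apply/quot_proj_eqP/asboolP.
by exists << s >>; rewrite bdry_edge.
Qed.

Section Augmentation.
Context (M : lmodType k) (g : Y -> M).
Hypothesis gP : forall y z, joined y z -> g y = g z.

Let aug : {linear sing_chain R k 0 Y -> M} :=
  fglift (fun s : sing_simplex R 0 Y => g (s simplex0_point)).

Lemma aug_bdry c : aug (sing_bdry R k 1 Y c) = 0.
Proof.
apply: (@freeg_linear_ext k _ _ (aug \o sing_bdry R k 1 Y) \0) => s.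
rewrite -[LHS]/(aug (sing_bdry R k 1 Y << s >>)) bdry_edge linearB /aug/=.
rewrite !liftU !scale1r /= (@gP (s (vertex ord0)) (s (vertex ord_max))) ?subrr//.
by exists s.
Qed.

Definition H0_lift_fun (x : sing_homology R k 0 Y) : M := aug (\val (quot_repr x)).

(** The chosen representative differs from [c] by a boundary, which [aug] kills; hence the choice
    made by [quot_repr] does not matter. *)
Lemma H0_lift_fun_class c : H0_lift_fun (chain_class c) = aug c.
Proof.
apply/eqP; rewrite /H0_lift_fun -subr_eq0 -linearB; apply/eqP.
set z : sing_cycle R k 0 Y := exist _ c (chain0_cycle c).
have /quot_proj_eqP/asboolP[e eE] :
    quot_proj (is_boundary_submod R k 0 Y) (quot_repr (chain_class c)) =
    quot_proj (is_boundary_submod R k 0 Y) z by rewrite quot_reprK.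
by rewrite -(aug_bdry e) eE.
Qed.

Lemma H0_lift_fun_linear : linear H0_lift_fun.
Proof.
move=> a x y; have [c ->] := chain_class_surj x; have [e ->] := chain_class_surj y.
by rewrite -linearP !H0_lift_fun_class linearP.
Qed.

(** Together with [H0_lift_point], this is the existence half of the universal property of H_0. It
    gives both the nonvanishing of point classes and the dimension count. *)
Definition H0_lift : {linear sing_homology R k 0 Y -> M} :=
  HB.pack H0_lift_fun
    (GRing.isLinear.Build _ _ _ _ H0_lift_fun H0_lift_fun_linear).

Lemma H0_lift_point y : H0_lift (point_class y) = g y.
Proof. by rewrite /H0_lift/= H0_lift_fun_class /aug/= liftU scale1r. Qed.

End Augmentation.

(** The linear form extending the constant function 1, that is, the augmentation, takes the value 1
    on a point class. *)
Lemma point_class_neq0 y : point_class y != 0.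
Proof.
apply/eqP => y0; have := @H0_lift_point k^o (fun=> 1) (fun _ _ _ => erefl) y.
rewrite y0 linear0 => e01; have /eqP := e01 : 0 = 1 :> k.
by rewrite eq_sym oner_eq0.
Qed.

Lemma H0_linear_ext (M : lmodType k) (f g : {linear sing_homology R k 0 Y -> M}) :
  (forall y, f (point_class y) = g (point_class y)) -> f =1 g.
Proof.
move=> fg; apply: H0_ind => [|a y x IH]; first by rewrite !linear0.
by rewrite !linearP fg IH.
Qed.

Lemma H0_path_connected y : (forall z, joined z y) ->
  forall x, exists a, x = a *: point_class y.
Proof.
move=> yP; apply: H0_ind => [|a z x [b ->]]; first by exists 0; rewrite scale0r.
by exists (a + b); rewrite (joined_point_class (yP z)) scalerDl.
Qed.

(** Here [c] labels the path components by [T] and [r] picks a base point in each. The lift of the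
    indicator vectors of labels and the map [h], which sends a basis vector to the class of its base
    point, are mutually inverse. *)
Lemma H0_has_dim (T : finType) (c : Y -> T) (r : T -> Y) :
    cancel r c -> (forall y z, joined y z -> c y = c z) ->
    (forall y, joined y (r (c y))) ->
  has_dim (sing_homology R k 0 Y) #|T|.
Proof.
move=> rK cP yr.
pose g y : 'rV[k]_#|T| := delta_mx ord0 (enum_rank (c y)).
have gP y z : joined y z -> g y = g z by move=> /cP yz; rewrite /g yz.
pose h (v : 'rV[k]_#|T|) : sing_homology R k 0 Y :=
  \sum_i v ord0 i *: point_class (r (enum_val i)).
have h_lin : linear h.
  move=> a u v; rewrite /h scaler_sumr -big_split; apply: eq_bigr => i _ /=.
  by rewrite !mxE scalerDl scalerA.
pose H : {linear 'rV[k]_#|T| -> sing_homology R k 0 Y} :=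
  HB.pack h (GRing.isLinear.Build _ _ _ _ h h_lin).
exists (H0_lift gP); first exact: linearP.
exists H => [x|v].
  apply: (H0_linear_ext (f := H \o H0_lift gP) (g := idfun)) => y.
  rewrite -[LHS]/(h (H0_lift gP (point_class y))) H0_lift_point /h.
  rewrite (bigD1 (enum_rank (c y)))//= big1 ?addr0 => [|i ne].
    by rewrite mxE !eqxx scale1r enum_rankK -(joined_point_class (yr y)).
  by rewrite mxE eqxx (negPf ne) scale0r.
rewrite -[H v]/(h v) /h linear_sum [RHS]row_sum_delta; apply: eq_bigr => i _.
by rewrite linearZ_LR H0_lift_point /g rK enum_valK.
Qed.

End Classes.

Lemma homology_map_point Y Z (f : continuousType Y Z) y :
  sing_homology_map R k 0 f (point_class y) = point_class (f y).
Proof.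
rewrite /point_class /chain_class [LHS]quot_map_proj; congr quot_proj.
apply: val_inj; rewrite /= liftU scale1r.
by congr << _ >>; apply/continuousEP.
Qed.

Lemma joined_refl Y (y : Y) : joined y y.
Proof. by exists (cst y : continuousType (std_simplex R 1) Y). Qed.

End ZerothHomology.

Arguments point_class {R k Y}.

(** * Paths parametrized by the standard 1-simplex *)

Section Paths.
Context (R : realType).

(** Clamping makes the parametrization [edge] of the 1-simplex total and continuous on all of [R],
    so that the intermediate value theorem applies to its composite with a function on the
    simplex. *)
Let clamp (u : R) : R := Num.max 0 (Num.min 1 u).

Let clamp01 u : 0 <= clamp u <= 1.
Proof. by rewrite le_max lexx /= ge_max ler01 ge_min lexx. Qed.

Let clamp_continuous : continuous clamp.
Proof.
move=> u; apply: continuous_max; first exact: cvg_cst.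
by apply: continuous_min; [exact: cvg_cst|exact: cvg_id].
Qed.

Lemma vertexE (i j : 'I_2) : set_val (vertex R i) ord0 j = (i != j)%:R.
Proof.
rewrite mxE; case: unliftP => [l ->|->]; last by rewrite eqxx.
by rewrite mxE neq_lift.
Qed.

Let edge_vec (u : R) : 'rV[R]_2 :=
  (1 - clamp u) *: set_val (vertex R ord0) + clamp u *: set_val (vertex R ord_max).

Let edge_vecE u i : edge_vec u ord0 i =
  (1 - clamp u) * (ord0 != i)%:R + clamp u * (ord_max != i)%:R.
Proof. by rewrite [LHS]mxE [X in X + _]mxE [X in _ + X]mxE !vertexE. Qed.

Let edge_simplex u : edge_vec u \in std_simplex R 1.
Proof.
have /andP[c0 c1] := clamp01 u.
rewrite inE; split=> [i|]; last first.
  by rewrite big_ord_recl big_ord1 !edge_vecE/= !(mulr1, mulr0, addr0, add0r) subrKC.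
by rewrite edge_vecE addr_ge0// mulr_ge0// subr_ge0.
Qed.

Let edge u : std_simplex R 1 := exist _ (edge_vec u) (edge_simplex u).

Let edge_continuous : continuous edge.
Proof.
apply: continuous_comp_initial => u; apply: cvgD.
  by apply: cvgZr_tmp; apply: cvgB; [exact: cvg_cst|exact: clamp_continuous].
by apply: cvgZr_tmp; exact: clamp_continuous.
Qed.

Let edge0 : edge 0 = vertex R ord0.
Proof.
apply: val_inj; rewrite /= /edge_vec /clamp (min_idPr ler01) maxxx.
by rewrite subr0 scale1r scale0r addr0.
Qed.

Let edge1 : edge 1 = vertex R ord_max.
Proof.
apply: val_inj; rewrite /= /edge_vec /clamp minxx (max_idPr ler01).
by rewrite subrr scale1r scale0r add0r.
Qed.

(** This is the form in which total disconnectedness of a finite set of reals is used: it keeps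
    distinct marked points from being joined. *)
Lemma finite_valued_path (S : seq R) (h : std_simplex R 1 -> R) :
  continuous h -> (forall x, h x \in S) ->
  h (vertex R ord0) = h (vertex R ord_max).
Proof.
move=> hc hS; rewrite -edge0 -edge1; set l := h _; set r := h _.
apply/eqP; apply: contraT => lr.
(* Infinitely many values between [l] and [r], all attained by [h]. *)
pose v (j : nat) := l + (r - l) / j.+1%:R.
have vS j : v j \in S.
  have [||u _ <-] := @IVT R (h \o edge) 0 1 (v j) ler01; last exact: hS.
    apply: continuous_subspaceT => u.
    by apply: continuous_comp; [exact: edge_continuous|exact: hc].
  have j0 : 0 <= (j.+1%:R^-1 : R) <= 1.
    by rewrite invr_ge0 ler0n /= invf_le1 ?ler1n ?ltr0n.
  rewrite /= -/l -/r /v; move: j0; set w := _^-1 => /andP[w0 w1].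
  by case: (leP l r) => lr'; apply/andP; split; nra.
(* Pigeonhole: as [r - l] is nonzero, the first [size S + 1] values of [v] are distinct, yet all lie
   in [S]. *)
have : (size S < size [seq v j | j <- iota 0 (size S).+1])%N.
  by rewrite size_map size_iota.
rewrite ltnNge uniq_leq_size//; last by move=> _ /mapP[j _ ->].
rewrite map_inj_uniq ?iota_uniq// => i j /addrI/mulfI.
rewrite subr_eq0 eq_sym => /(_ lr)/invr_inj/eqP.
by rewrite eqr_nat => /eqP[].
Qed.

(** The last coordinate weights the starting value [t] because [vertex ord0], where the path starts,
    is (0, 1). *)
Definition affine_path (t t' : R) (x : std_simplex R 1) : R :=
  set_val x ord0 ord_max * t + set_val x ord0 ord0 * t'.

Lemma affine_path_itv a b t t' x :
  a <= t <= b -> a <= t' <= b -> a <= affine_path t t' x <= b.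
Proof.
move=> /andP[at_ tb] /andP[at' t'b].
have [x0 x1] : std_simplex R 1 (set_val x) by exact: set_valP.
have := x0 ord0; have := x0 ord_max; move: x1; rewrite /affine_path.
rewrite big_ord_recl big_ord1 (_ : fintype.lift _ _ = ord_max); last exact: val_inj.
set u := set_val x _ _; set w := set_val x _ _ => uw w0 u0.
nra.
Qed.

Lemma affine_path_continuous t t' : continuous (affine_path t t').
Proof.
have comb : continuous (fun v : 'rV[R]_2 => v ord0 ord_max * t + v ord0 ord0 * t').
  move=> v; have c i r : w ord0 i * r @[w --> nbhs v] --> v ord0 i * r.
    by apply: (@cvgMr_tmp R _ (nbhs v)); exact: coord_continuous.
  exact: (@cvgD _ _ _ (nbhs v) _ _ _ _ _ (c _ _) (c _ _)).
move=> x; apply: (@continuous_comp _ _ _ set_val _ _ _ (comb _)).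
exact: initial_continuous.
Qed.

Lemma affine_path0 t t' : affine_path t t' (vertex R ord0) = t.
Proof. by rewrite /affine_path !vertexE mul1r mul0r addr0. Qed.

Lemma affine_path1 t t' : affine_path t t' (vertex R ord_max) = t'.
Proof. by rewrite /affine_path !vertexE mul1r mul0r add0r. Qed.

End Paths.

(** * The family over a point, its homology and its endomorphisms *)

Section SpikedFamily.
Context (R : realType) (k : fieldType) (N : nat) (p : 'I_N -> R).
Hypothesis p_inj : injective p.
Hypothesis p01 : forall i, 0 <= p i <= 1.

(* The one-point space. *)
Local Notation X := ('rV[R]_0 : topologicalType).
Local Notation P := (delta2 R *p R)%type.

Lemma mem_unit_itv (t : R) : 0 <= t <= 1 -> t \in unit_itv R.
Proof. by rewrite inE /unit_itv /= in_itv. Qed.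

Let delta2_full_subproof : @is_delta2 R (0, 1).
Proof. by rewrite /is_delta2/= ler01 !lexx. Qed.

Definition delta2_full : delta2 R := Delta2 delta2_full_subproof.

Definition spiked (u : unit_itv R * X) : R :=
  if [exists i, p i == val u.1] then 0 else 1.

Local Notation M := (family_module k spiked 0).

Lemma family_spaceP (q : P) (u : unit_itv R * X) :
  (u \in family_space spiked q) =
  (q.1.1 <= val u.1 <= q.1.2) && (spiked u <= q.2).
Proof.
case: q => ab c; apply/idP/andP => /=.
  by rewrite inE /family_space set_itvE => -[].
by move=> [? ?]; rewrite inE /family_space set_itvE.
Qed.

Lemma spiked_le1 u : spiked u <= 1.
Proof. by rewrite /spiked; case: ifP. Qed.

Lemma spiked_ge0 u : 0 <= spiked u.
Proof. by rewrite /spiked; case: ifP. Qed.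

Lemma family_point_eq (q : P) (y z : family_space spiked q) :
  val (val y).1 = val (val z).1 -> y = z.
Proof.
case: y z => [[s x] ys] [[t y] yt] /= st; apply: val_inj => /=.
by congr pair; [exact: val_inj | apply/rowP; case].
Qed.

Lemma height_continuous (q : P) :
  continuous (fun y : family_space spiked q => val (val y).1 : R).
Proof.
move=> y; apply: (@continuous_comp (family_space spiked q) (unit_itv R) R
  (fun y => (val y).1) val); last exact: initial_continuous.
apply: (@continuous_comp (family_space spiked q) (unit_itv R * X)%type
  (unit_itv R) val fst); first exact: initial_continuous.
exact: cvg_fst.
Qed.

(** Since [spiked] is at most 1, the bound on the value excludes nothing, and the segment between
    the two heights stays in [a, b] by convexity. *)
Lemma high_joined (q : P) (y z : family_space spiked q) :
  1 <= q.2 -> joined R y z.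
Proof.
move=> c1.
have := valP y; rewrite family_spaceP => /andP[yI _].
have := valP z; rewrite family_spaceP => /andP[zI _].
set t := val (val y).1 in yI; set t' := val (val z).1 in zI.
have unitP (s : R) : q.1.1 <= s <= q.1.2 -> s \in unit_itv R.
  case/andP=> h1 h2; have /and3P[h3 _ h4] := valP q.1.
  by rewrite mem_unit_itv// (le_trans h3 h1) (le_trans h2 h4).
have sI x := affine_path_itv x yI zI.
pose h (x : std_simplex R 1) : unit_itv R :=
  exist _ (affine_path t t' x) (unitP _ (sI x)).
pose f x : unit_itv R * X := (h x, 0).
have hc : continuous h.
  by apply: continuous_comp_initial; exact: affine_path_continuous.
have fP x : f x \in family_space spiked q.
  by rewrite family_spaceP sI (le_trans (spiked_le1 _) c1).
pose g (x : std_simplex R 1) : family_space spiked q := exist _ (f x) (fP x).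
have gc : continuous g.
  apply: continuous_comp_initial => x.
  exact: (@cvg_pair _ _ _ (nbhs x) (nbhs (h x)) (nbhs (0 : X)) _ _ _
    h (fun=> 0) (hc x) (cvg_cst _)).
pose G : sing_simplex R 1 (family_space spiked q) :=
  HB.pack g (isContinuous.Build _ _ g gc).
exists G; split; apply: family_point_eq => /=.
  exact: affine_path0.
exact: affine_path1.
Qed.

(** Below level 1 only marked points survive, so the height along a path takes values in the finite
    set [codom p]. *)
Lemma low_joined (q : P) (y z : family_space spiked q) :
  q.2 < 1 -> joined R y z -> y = z.
Proof.
move=> c1 [s [<- <-]]; apply: family_point_eq.
apply: (@finite_valued_path R (codom p) (fun x => val (val (s x)).1)).
  move=> x; apply: (@continuous_comp _ _ _ s (fun y => val (val y).1)).
    exact: cts_fun.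
  exact: height_continuous.
move=> x; have := valP (s x); rewrite family_spaceP => /andP[_].
rewrite /spiked; case: existsP => [[i /eqP <- _]|_ /le_lt_trans/(_ c1)].
  exact: codom_f.
by rewrite ltxx.
Qed.

(** The condition [0 <= q.2] empties the set at negative levels, where the space is empty too, so
    one dimension formula covers every level below 1. *)
Definition spikes (q : P) : {set 'I_N} :=
  [set i | (q.1.1 <= p i <= q.1.2) && (0 <= q.2)].

Lemma low_has_dim (q : P) : q.2 < 1 -> has_dim (M q) #|spikes q|.
Proof.
move=> c1.
have p_unit i : p i \in unit_itv R by exact: mem_unit_itv.
pose pt i : unit_itv R * X := (exist _ (p i) (p_unit i), 0).
have rP (i : {i | i \in spikes q}) : pt (val i) \in family_space spiked q.
  rewrite family_spaceP; have := valP i; rewrite inE /= => /andP[-> c0] /=.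
  by rewrite /spiked; case: existsP => // -[]; exists (val i).
pose r i : family_space spiked q := exist _ (pt (val i)) (rP i).
have cP (y : family_space spiked q) : exists i : {i | i \in spikes q}, r i = y.
  have := valP y; rewrite family_spaceP => /andP[yI yc].
  have : [exists i, p i == val (val y).1].
    by apply: contraTT yc; rewrite /spiked -ltNge => /negPf ->.
  case/existsP => i /eqP py.
  have iS : i \in spikes q.
    by rewrite inE py yI (le_trans (spiked_ge0 _) yc).
  by exists (exist _ i iS); apply: family_point_eq.
(* The labelling [c] is a right inverse of [r]; injectivity of [p] makes it a left inverse as well,
   so every point is its own component. *)
have [c cK] := choice cP.
rewrite -(card_sig (mem (spikes q))).
apply: (@H0_has_dim R k _ _ c r) => [i|y z /(low_joined c1) -> //|y].
  have /(congr1 (fun y => val (val y).1))/= /p_inj := cK (r i).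
  exact: (@val_inj _ _ {i | i \in spikes q}).
by rewrite cK; exact: joined_refl.
Qed.

Lemma high_has_dim (q : P) : 1 <= q.2 -> has_dim (M q) 1.
Proof.
move=> c1; have /and3P[a0 ab b1] := valP q.1.
have aU : q.1.1 \in unit_itv R.
  by rewrite mem_unit_itv// a0 (le_trans ab b1).
pose y : unit_itv R * X := (exist _ q.1.1 aU, 0).
have yP : y \in family_space spiked q.
  by rewrite family_spaceP /= lexx ab (le_trans (spiked_le1 _) c1).
suff : has_dim (M q) #|{: unit}| by rewrite card_unit.
pose r (_ : unit) : family_space spiked q := exist _ y yP.
apply: (@H0_has_dim R k _ _ (fun=> tt) r) => [[]//|//|z].
exact: high_joined.
Qed.

Lemma spiked_end_scalar (phi : pers_hom M M) :
  exists a, forall q v, phi q v = a *: v.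
Proof.
pose r : P := (delta2_full, 1).
have oU : (0 : R) \in unit_itv R by rewrite mem_unit_itv// lexx ler01.
pose o0 : unit_itv R * X := (exist _ 0 oU, 0).
have oP : o0 \in family_space spiked r.
  by rewrite family_spaceP /= lexx ler01 spiked_le1.
pose o : family_space spiked r := exist _ o0 oP.
have oj z : joined R z o by apply: high_joined.
have [a ha] := H0_path_connected oj (phi r (point_class o)).
exists a => q.
pose sc : {linear M q -> M q} := a \*: idfun.
apply: (H0_linear_ext (f := phi q) (g := sc)) => y.
have := valP y; rewrite family_spaceP => /andP[yI yc].
pose t : R := val (val y).1.
have t01 : 0 <= t <= 1.
  by have := valP (val y).1; rewrite inE /unit_itv /= in_itv.
have sP : @is_delta2 R (t, t) by rewrite /is_delta2/= lexx.
(* The least index whose space contains the point [y]; its interval is reduced to [t], so the space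
   is a single point and its H_0 a line. *)
pose s : P := (Delta2 sP, spiked (val y)).
have yS : val y \in family_space spiked s by rewrite family_spaceP /= !lexx.
pose ys : family_space spiked s := exist _ (val y) yS.
have sq : (s <= q)%O by apply/andP; split.
have sr : (s <= r)%O by apply/andP; split => //; exact: spiked_le1.
have ys_all z : joined R z ys.
  suff -> : z = ys by exact: joined_refl.
  apply: family_point_eq; apply/esym/le_anti.
  by have := valP z; rewrite family_spaceP => /andP[].
have [b hb] := H0_path_connected ys_all (phi s (point_class ys)).
have hr : module_map M sr (point_class ys) = point_class o.
  by rewrite [LHS]homology_map_point; exact: joined_point_class.
have hq : module_map M sq (point_class ys) = point_class y.
  by rewrite [LHS]homology_map_point; congr point_class; exact: val_inj.
(* Naturality from [s] to [r] compares the two scalars on the nonzero class of [o]. *)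
have ab : b = a.
  have := hom_natural phi sr (point_class ys).
  rewrite hb hr ha linearZ_LR hr => /eqP.
  rewrite -subr_eq0 -scalerBl scaler_eq0 (negPf (point_class_neq0 R k o)) orbF.
  by rewrite subr_eq0 => /eqP.
by rewrite -hq hom_natural hb linearZ_LR ab.
Qed.

Lemma spiked_max_dim : (1 <= N)%N -> has_max_dim M N.
Proof.
move=> N1; split.
  exists (delta2_full, 0).
  have := low_has_dim (q := (delta2_full, 0)) ltr01.
  suff -> : spikes (delta2_full, 0) = [set: 'I_N]%SET by rewrite cardsT card_ord.
  by apply/setP => i; rewrite !inE /= p01 lexx.
move=> q; have [c1|c1] := ltP q.2 1.
  exists #|spikes q|; first exact: low_has_dim.
  by rewrite -[leqRHS]card_ord max_card.
(* The remaining bound is [N1]: the lines at levels at least 1 do not exceed the maximum. *)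
by exists 1%N; first exact: high_has_dim.
Qed.

End SpikedFamily.

Theorem mainTheorem3 (R : realType) (k : fieldType) (N : nat) :
  (1 <= N)%N ->
  exists (X : topologicalType) (ft : (unit_itv R * X)%type -> R) (j : nat),
    indecomposable (family_module k ft j) /\
    exists2 m : nat, has_max_dim (family_module k ft j) m & (N <= m)%N.
Proof.
(* Any [N] distinct points of the unit interval would serve as marked points. *)
move=> N1; pose p (i : 'I_N) : R := i.+1%:R^-1.
have p_inj : injective p.
  by move=> i j /invr_inj/eqP; rewrite eqr_nat => /eqP[] /val_inj.
have p01 i : 0 <= p i <= 1.
  by rewrite invr_ge0 ler0n /= invf_le1 ?ler1n ?ltr0n.
exists 'rV[R]_0, (spiked p), 0%N; split.
  exact/scalar_end_indecomposable/spiked_end_scalar.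
by exists N; first exact: spiked_max_dim.
Qed.
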